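(* For every integer $n\ge 3$ there is an instance of Max Min Agreements on $n$ vertices (with all weights equal to $1$) such that the maximum over all clusterings $\mathcal S$ of $\min_{u\in V}\mathrm{agree}_{\mathcal S}(u)$ is at most $\frac{n}{2(n-1)}$ times the optimal value of the natural LP relaxation, and also at most $\frac{n}{2(n-1)}$ times the optimal value of the natural SDP relaxation. That is, both relaxations have integrality gap $\frac{n}{2(n-1)}$.
   Context: An instance consists of an undirected graph $G=(V,E)$, $n=|V|$, non-negative edge weights $c$, and a partition of $E$ into $E^+$ and $E^-$. A clustering is a partition $\mathcal S=\{S_1,\dots,S_\ell\}$ of $V$ into an arbitrary number of parts. For $u\in S_i$, $\mathrm{agree}_{\mathcal S}(u)=\sum_{v\in S_i,(u,v)\in E^+}c_{u,v}+\sum_{v\notin S_i,(u,v)\in E^-}c_{u,v}$. Max Min Agreements asks for a clustering maximizing $\min_u\mathrm{agree}_{\mathcal S}(u)$. Natural LP relaxation: maximize $\min_{u}A(u)$ subject to $A(u)=\sum_{v:(u,v)\in E^+}c_{u,v}(1-d(u,v))+\sum_{v:(u,v)\in E^-}c_{u,v}d(u,v)$ for all $u$; $d(u,v)+d(v,w)\ge d(u,w)$ for all $u,v,w$; $A(u)\ge0$, $0\le d(u,v)\le1$. Natural SDP relaxation: vectors $y_u$ ($u\in V$) with $y_u\cdot y_u=1$, $y_u\cdot y_v\ge0$, $\|y_u-y_v\|_2^2+\|y_v-y_w\|_2^2\ge\|y_u-y_w\|_2^2$ for all $u,v,w$; maximize $\min_u A(u)$ where $A(u)=\sum_{v:(u,v)\in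 E^+}c_{u,v}\,y_u\cdot y_v+\sum_{v:(u,v)\in E^-}c_{u,v}(1-y_u\cdot y_v)$. *)

(* Defs.v *)
From mathcomp Require Import all_boot all_order all_algebra.
From mathcomp Require Import all_classical all_reals.

Set Implicit Arguments.
Unset Strict Implicit.
Unset Printing Implicit Defensive.

Import Order.TTheory GRing.Theory Num.Theory.

Local Open Scope ring_scope.

(* Edge sets are symmetric relations, so each undirected edge {u, v} is present
   as both (u, v) and (v, u); [weight] is only meaningful on edges. *)
Record instance (R : realType) (V : finType) := Instance {
  edge : rel V;
  pos_edge : rel V;
  neg_edge : rel V;
  weight : V -> V -> R;
  edge_irr : irreflexive edge;
  pos_edge_sym : symmetric pos_edge;
  neg_edge_sym : symmetric neg_edge;
  edge_cover : forall u v, edge u v = pos_edge u v || neg_edge u v;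
  edge_disjoint : forall u v, ~~ (pos_edge u v && neg_edge u v);
  weight_sym : forall u v, weight u v = weight v u;
  weight_ge0 : forall u v, edge u v -> 0 <= weight u v
}.

Definition unit_weights (R : realType) (V : finType) (I : instance R V) : Prop :=
  forall u v, edge I u v -> weight I u v = 1.

(* For nonempty V this infimum is over a finite nonempty set, hence a minimum. *)
Definition min_over (R : realType) (V : finType) (F : V -> R) : R :=
  inf [set F u | u in [set: V]]%classic.

Definition clustering (V : finType) (S : {set {set V}}) : bool :=
  finset.partition S [set: V]%SET.

Definition agree (R : realType) (V : finType) (I : instance R V)
    (S : {set {set V}}) (u : V) : R :=
  \sum_(v | (v \in finset.pblock S u) && pos_edge I u v) weight I u v +
  \sum_(v | (v \notin finset.pblock S u) && neg_edge I u v) weight I u v.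

Definition max_min_agree (R : realType) (V : finType) (I : instance R V) : R :=
  sup [set x | exists S : {set {set V}},
         clustering S /\ x = min_over (agree I S)]%classic.

Definition lp_A (R : realType) (V : finType) (I : instance R V)
    (d : V -> V -> R) (u : V) : R :=
  \sum_(v | pos_edge I u v) weight I u v * (1 - d u v) +
  \sum_(v | neg_edge I u v) weight I u v * d u v.

(* Symmetry expresses that there is one variable per unordered pair. *)
Definition lp_feasible (R : realType) (V : finType) (I : instance R V)
    (d : V -> V -> R) : Prop :=
  [/\ forall u v, d u v = d v u,
      forall u v w, d u w <= d u v + d v w,
      forall u, 0 <= lp_A I d u
    & forall u v, 0 <= d u v <= 1].

Definition lp_opt (R : realType) (V : finType) (I : instance R V) : R :=
  sup [set x | exists d : V -> V -> R,
         lp_feasible I d /\ x = min_over (lp_A I d)]%classic.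

Definition dot (R : realType) (m : nat) (x y : 'rV[R]_m) : R :=
  \sum_i x 0 i * y 0 i.

(* The Euclidean norm: `|x| on row vectors would be the max norm. *)
Definition sqnorm (R : realType) (m : nat) (x : 'rV[R]_m) : R := dot x x.

Definition sdp_A (R : realType) (V : finType) (I : instance R V)
    (m : nat) (y : V -> 'rV[R]_m) (u : V) : R :=
  \sum_(v | pos_edge I u v) weight I u v * dot (y u) (y v) +
  \sum_(v | neg_edge I u v) weight I u v * (1 - dot (y u) (y v)).

Definition sdp_feasible (R : realType) (V : finType)
    (m : nat) (y : V -> 'rV[R]_m) : Prop :=
  [/\ forall u, dot (y u) (y u) = 1,
      forall u v, 0 <= dot (y u) (y v)
    & forall u v w,
        sqnorm (y u - y w) <= sqnorm (y u - y v) + sqnorm (y v - y w)].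

(* The vectors may live in any finite dimension m. *)
Definition sdp_opt (R : realType) (V : finType) (I : instance R V) : R :=
  sup [set x | exists (m : nat) (y : V -> 'rV[R]_m),
         sdp_feasible y /\ x = min_over (sdp_A I y)]%classic.

(* Main.v *)
(** The instance is the cycle [0, 1, ..., n-1] in which the edge [{0, n-1}] is
    negative and all others are positive.  If all positive edges of a clustering
    agree, then [0] and [n-1] lie in the same part and the negative edge
    disagrees; hence some edge always disagrees and its endpoints, having
    degree 2, have agreement at most 1.  Spreading the unit of disagreement
    evenly over the [n] edges, [d i j = |i - j| / n], gives every vertex the
    fractional agreement [2 (n - 1) / n].  The same values arise from the SDP:
    the normalized indicator vectors of the intervals [[i, i + n)] have inner
    products [1 - |i - j| / n]. *)
Require Import Defs.
From mathcomp Require Import all_boot all_order all_algebra.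
From mathcomp Require Import all_classical all_reals.
From mathcomp Require Import zify ring lra.

Set Implicit Arguments.
Unset Strict Implicit.
Unset Printing Implicit Defensive.

Import Order.TTheory GRing.Theory Num.Theory.

Local Open Scope ring_scope.

(** * Minima over vertices, and a common form of the three objectives *)

Lemma min_over_le (R : realType) (V : finType) (F : V -> R) (u : V) :
  min_over F <= F u.
Proof.
apply: ge_inf; last by exists u.
exists (- \sum_v `|F v|) => _ [v _ <-].
rewrite lerNl (bigD1 v) //= -[leLHS]addr0 lerD ?sumr_ge0 //.
by rewrite -normrN ler_norm.
Qed.

Lemma le_min_over (R : realType) (V : finType) (F : V -> R) (u0 : V) (c : R) :
  (forall u, c <= F u) -> c <= min_over F.
Proof.
by move=> cF; apply: lb_le_inf; [exists (F u0), u0 | move=> _ [u _ <-]].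
Qed.

(** A clustering is the LP point with distance 0 inside a part and 1 across parts, so bounds on
    [lp_A] apply to clusterings too. *)
Lemma agree_lp_A (R : realType) (V : finType) (I : instance R V)
    (S : {set {set V}}) :
  agree I S =1 lp_A I (fun u v => (v \notin finset.pblock S u)%:R).
Proof.
move=> u; rewrite /agree /lp_A; congr (_ + _).
  rewrite big_mkcond [RHS]big_mkcond; apply: eq_bigr => v _.
  by case: (v \in _); case: (pos_edge _ _ _); rewrite ?subr0 ?subrr ?mulr1 ?mulr0.
rewrite big_mkcond [RHS]big_mkcond; apply: eq_bigr => v _.
by case: (v \in _); case: (neg_edge _ _ _); rewrite ?mulr1 ?mulr0.
Qed.

Lemma sdp_A_lp_A (R : realType) (V : finType) (I : instance R V)
    (m : nat) (y : V -> 'rV[R]_m) :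
  sdp_A I y =1 lp_A I (fun u v => 1 - dot (y u) (y v)).
Proof.
by move=> u; rewrite /sdp_A /lp_A; congr (_ + _); apply: eq_bigr => v _; rewrite subKr.
Qed.

Lemma sqnormB (R : realType) (m : nat) (x y : 'rV[R]_m) :
  sqnorm (x - y) = dot x x + dot y y - 2 * dot x y.
Proof.
rewrite /sqnorm /dot mulr_sumr -sumrN -!big_split /=.
by apply: eq_bigr => i _; rewrite !mxE; ring.
Qed.

(** Cauchy-Schwarz for unit vectors, read off from [0 <= sqnorm (x - y) = 2 - 2 * dot x y]. *)
Lemma dot_le1 (R : realType) (m : nat) (x y : 'rV[R]_m) :
  dot x x = 1 -> dot y y = 1 -> dot x y <= 1.
Proof.
move=> x1 y1; have : 0 <= sqnorm (x - y).
  by apply: sumr_ge0 => i _; rewrite -expr2 sqr_ge0.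
rewrite sqnormB x1 y1; lra.
Qed.

(** * The cycle instance and its two-term objective *)

Definition path_adj (n : nat) (u v : 'I_n) : bool :=
  (u.+1 == v)%N || (v.+1 == u)%N.

(* On ['I_n] this says [{u, v} = {0, n - 1}]. *)
Definition end_adj (n : nat) (u v : 'I_n) : bool :=
  (u + n.-1 == v)%N || (v + n.-1 == u)%N.

Lemma path_adj_sym (n : nat) : symmetric (@path_adj n).
Proof. by move=> u v; rewrite /path_adj orbC. Qed.

Lemma end_adj_sym (n : nat) : symmetric (@end_adj n).
Proof. by move=> u v; rewrite /end_adj orbC. Qed.

Lemma cycle_adj_irr (n : nat) : (3 <= n)%N ->
  irreflexive (fun u v : 'I_n => path_adj u v || end_adj u v).
Proof. move=> hn u; rewrite /path_adj /end_adj; lia. Qed.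

Lemma path_end_disjoint (n : nat) : (3 <= n)%N ->
  forall u v : 'I_n, ~~ (path_adj u v && end_adj u v).
Proof.
move=> hn u v; rewrite /path_adj /end_adj.
have := ltn_ord u; have := ltn_ord v; lia.
Qed.

Definition cycle_instance (R : realType) (n : nat) (hn : (3 <= n)%N) :
    instance R 'I_n :=
  @Instance R 'I_n _ (@path_adj n) (@end_adj n) (fun _ _ => 1)
    (cycle_adj_irr hn) (@path_adj_sym n) (@end_adj_sym n)
    (fun _ _ => erefl) (path_end_disjoint hn) (fun _ _ => erefl)
    (fun _ _ _ => ler01).

Lemma val_ordS (n : nat) (u : 'I_n) :
  ordS u = (if u.+1 == n then 0 else u.+1)%N :> nat.
Proof.
rewrite /=; case: eqP => [->|ne]; first by rewrite modnn.
by rewrite modn_small //; have := ltn_ord u; lia.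
Qed.

Lemma val_ord_pred (n : nat) (u : 'I_n) :
  ord_pred u = (if u == 0 :> nat then n.-1 else u.-1)%N :> nat.
Proof.
have := ltn_ord u; rewrite /=; case: eqP => [->|ne] un.
  by rewrite add0n modn_small //; lia.
by have -> : (u + n).-1 = (u.-1 + n)%N; [lia | rewrite modnDr modn_small //; lia].
Qed.

Lemma cycle_adjE (n : nat) (u v : 'I_n) : (3 <= n)%N ->
  path_adj u v || end_adj u v = (v == ordS u) || (v == ord_pred u).
Proof.
move=> hn; rewrite -!val_eqE /path_adj /end_adj.
have := val_ordS u; have := val_ord_pred u.
move: (ordS u) (ord_pred u) (ltn_ord u) (ltn_ord v) => s p /= un vn.
by case: ifP => u0 ->; case: ifP => un1 ->; lia.
Qed.

(** Every vertex thus has degree exactly 2; for [n = 2] the two neighbours would coincide. *)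
Lemma ordS_neq_pred (n : nat) (u : 'I_n) : (3 <= n)%N -> ord_pred u != ordS u.
Proof.
move=> hn; rewrite -val_eqE.
have := val_ordS u; have := val_ord_pred u.
move: (ordS u) (ord_pred u) (ltn_ord u) => s p /= un.
by case: ifP => u0 ->; case: ifP => un1 ->; lia.
Qed.

(** Meaningful only on edges of the cycle, where an edge outside the path is the negative one. *)
Definition edge_score (R : realType) (n : nat) (d : 'I_n -> 'I_n -> R)
    (u v : 'I_n) : R :=
  if path_adj u v then 1 - d u v else d u v.

Lemma lp_A_cycle (R : realType) (n : nat) (hn : (3 <= n)%N)
    (d : 'I_n -> 'I_n -> R) (u : 'I_n) :
  lp_A (cycle_instance R hn) d u =
  edge_score d u (ordS u) + edge_score d u (ord_pred u).
Proof.
(* As no edge is both positive and negative, the two sums merge into one over all neighbours. *)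
transitivity (\sum_(v | path_adj u v || end_adj u v) edge_score d u v).
  rewrite /lp_A /= big_mkcond [X in _ + X]big_mkcond -big_split [RHS]big_mkcond.
  apply: eq_bigr => v _; rewrite /edge_score /= !mul1r.
  have := path_end_disjoint hn u v.
  by case: path_adj; case: end_adj; rewrite //= ?addr0 ?add0r.
rewrite (eq_bigl _ _ (fun v => cycle_adjE u v hn)) (bigD1 (ordS u)) ?eqxx //=.
rewrite (bigD1 (ord_pred u)) /= ?eqxx ?orbT ?ordS_neq_pred //.
rewrite big1 ?addr0 // => v /andP[/andP[/orP[->|->]//]]; by rewrite andbF.
Qed.

Lemma edge_score_bounds (R : realType) (n : nat) (d : 'I_n -> 'I_n -> R)
    (u v : 'I_n) : 0 <= d u v <= 1 -> 0 <= edge_score d u v <= 1.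
Proof. by rewrite /edge_score; case: ifP => _ /andP[? ?]; apply/andP; split; lra. Qed.

Lemma lp_A_cycle_le2 (R : realType) (n : nat) (hn : (3 <= n)%N)
    (d : 'I_n -> 'I_n -> R) (u : 'I_n) :
  (forall v, 0 <= d u v <= 1) -> lp_A (cycle_instance R hn) d u <= 2.
Proof.
move=> d01; rewrite lp_A_cycle.
have /andP[_ ?] := edge_score_bounds (d01 (ordS u)).
have /andP[_ ?] := edge_score_bounds (d01 (ord_pred u)).
lra.
Qed.

(** Only the other edge at [u] can contribute, and it scores at most 1. *)
Lemma lp_A_cycle_le1 (R : realType) (n : nat) (hn : (3 <= n)%N)
    (d : 'I_n -> 'I_n -> R) (u v : 'I_n) :
  (forall v, 0 <= d u v <= 1) ->
  path_adj u v || end_adj u v -> edge_score d u v = 0 ->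
  lp_A (cycle_instance R hn) d u <= 1.
Proof.
move=> d01; rewrite cycle_adjE // lp_A_cycle.
have /andP[_ ?] := edge_score_bounds (d01 (ordS u)).
have /andP[_ ?] := edge_score_bounds (d01 (ord_pred u)).
by case/orP => /eqP -> ->; lra.
Qed.

(** * Upper bound for clusterings *)

Lemma cycle_disagreement (n : nat) (S : {set {set 'I_n}}) :
  (3 <= n)%N -> clustering S ->
  exists u v : 'I_n,
    (path_adj u v && (v \notin finset.pblock S u)) ||
    (end_adj u v && (v \in finset.pblock S u)).
Proof.
move=> hn /and3P[/eqP covS tiS _].
have [/existsP[u /existsP[v uv]]|noex] := boolP [exists u : 'I_n, exists v : 'I_n,
    path_adj u v && (v \notin finset.pblock S u)].
  by exists u, v; rewrite uv.
have step (u v : 'I_n) : path_adj u v -> v \in finset.pblock S u.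
  move=> uv; apply: contraNT noex => vu.
  by apply/existsP; exists u; apply/existsP; exists v; rewrite uv.
have n0 : (0 < n)%N by lia.
(* Induction along the path carries the part of vertex 0 to every vertex, in particular to
   [n.-1]. *)
have inblock k (kn : (k < n)%N) : Ordinal kn \in finset.pblock S (Ordinal n0).
  elim: k kn => [|k IHk] kn.
    by rewrite (bool_irrelevance kn n0) mem_pblock covS inE.
  have k'n : (k < n)%N by lia.
  rewrite -(same_pblock tiS (IHk k'n)).
  by apply: step; rewrite /path_adj /= eqxx.
have nn : (n.-1 < n)%N by lia.
exists (Ordinal n0), (Ordinal nn).
by rewrite inblock /end_adj /= add0n eqxx orbT.
Qed.

Lemma max_min_agree_cycle (R : realType) (n : nat) (hn : (3 <= n)%N) :
  max_min_agree (cycle_instance R hn) <= 1.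
Proof.
rewrite /max_min_agree; set E := (X in sup X).
(* The supremum of the empty set is 0 by convention, so no clustering has to be exhibited. *)
have [->|E0] := eqVneq E set0; first by rewrite sup0.
apply: ge_sup; first exact/set0P.
move=> _ [S [clS ->]].
have [u [v uv]] := cycle_disagreement hn clS.
apply: (le_trans (min_over_le _ u)); rewrite agree_lp_A.
apply: (@lp_A_cycle_le1 _ _ _ _ _ v).
- by move=> w; case: (w \in _); rewrite /= ?lexx ler01.
- by case/orP: uv => /andP[-> _]; rewrite ?orbT.
(* Both kinds of disagreement score 0: a cut path edge has distance 1, an uncut end edge distance
   0. *)
- rewrite /edge_score; have := path_end_disjoint hn u v.
  by case/orP: uv => /andP[-> ->]; rewrite ?andbT ?subrr // => /negbTE ->.
Qed.

(** * Lower bound for the LP optimum *)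

Definition path_dist (R : realType) (n : nat) (u v : 'I_n) : R :=
  `|u%:R - v%:R| / n%:R.

Lemma path_dist_bounds (R : realType) (n : nat) (u v : 'I_n) :
  0 <= path_dist R u v <= 1.
Proof.
have n0 : (0 < n)%N by have := ltn_ord u; lia.
rewrite /path_dist divr_ge0 ?ler0n //= ler_pdivrMr ?ltr0n // mul1r.
have /ltW un : u%:R < n%:R :> R by rewrite ltr_nat.
have /ltW vn : v%:R < n%:R :> R by rewrite ltr_nat.
have u0 := ler0n R u; have v0 := ler0n R v.
by rewrite ler_norml; apply/andP; split; lra.
Qed.

Lemma path_dist_sym (R : realType) (n : nat) (u v : 'I_n) :
  path_dist R u v = path_dist R v u.
Proof. by rewrite /path_dist distrC. Qed.

Lemma path_dist_triangle (R : realType) (n : nat) (u v w : 'I_n) :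
  path_dist R u w <= path_dist R u v + path_dist R v w.
Proof.
by rewrite /path_dist -mulrDl ler_wpM2r ?invr_ge0 ?ler0n // ler_distD.
Qed.

(** A positive edge has length [1 / n] and scores the complement; the negative edge scores its own
    length [(n - 1) / n], which is the same number. *)
Lemma edge_score_path_dist (R : realType) (n : nat) (u v : 'I_n) :
  (3 <= n)%N -> path_adj u v || end_adj u v ->
  edge_score (@path_dist R n) u v = 1 - n%:R^-1.
Proof.
move=> hn; have n0 : n%:R != 0 :> R by rewrite pnatr_eq0; lia.
have normD (a b k : nat) : (a + k = b)%N ->
    `|a%:R - b%:R| = k%:R :> R /\ `|b%:R - a%:R| = k%:R :> R.
  move=> <-; rewrite natrD opprD addrA subrr sub0r normrN.
  by rewrite [X in _ /\ `|X| = _]addrAC subrr add0r normr_nat.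
rewrite /edge_score /path_dist; case: ifP => [+ _|_ /=].
  by case/orP => /eqP; rewrite -addn1 => /normD [a b]; rewrite ?a ?b div1r.
have n1 : n.-1%:R / n%:R = 1 - n%:R^-1 :> R.
  by rewrite -subn1 natrB ?mulrBl ?divff ?div1r //; lia.
by case/orP => /eqP /normD [a b]; rewrite ?a ?b n1.
Qed.

Lemma lp_A_path_dist (R : realType) (n : nat) (hn : (3 <= n)%N) (u : 'I_n) :
  lp_A (cycle_instance R hn) (@path_dist R n) u = 2 * (1 - n%:R^-1).
Proof.
by rewrite lp_A_cycle !edge_score_path_dist ?cycle_adjE ?eqxx ?orbT // mulr_natl mulr2n.
Qed.

Lemma lp_opt_cycle (R : realType) (n : nat) (hn : (3 <= n)%N) :
  2 * (1 - n%:R^-1) <= lp_opt (cycle_instance R hn).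
Proof.
have u0 : 'I_n by exists 0%N; lia.
apply: (@le_trans _ _ (min_over (lp_A (cycle_instance R hn) (@path_dist R n)))).
  by apply: le_min_over => // u; rewrite lp_A_path_dist.
apply: ub_le_sup.
  (* The supremum dominates its members only if the set is bounded: two edges per vertex, each
     scoring at most 1. *)
  exists 2 => _ [d [[_ _ _ d01] ->]].
  by apply: (le_trans (min_over_le _ u0)); apply: lp_A_cycle_le2.
exists (@path_dist R n); split=> //; split.
- exact: path_dist_sym.
- exact: path_dist_triangle.
- move=> u; rewrite lp_A_path_dist; apply: mulr_ge0 => //.
  by rewrite subr_ge0 invf_le1 ?ler1n ?ltr0n (ltnW (ltnW hn)).
- exact: path_dist_bounds.
Qed.

(** * Lower bound for the SDP optimum *)

(** Since [u < n], all the intervals fit into [n + n] coordinates; each has [n] points, hence the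
    scaling to unit length. *)
Definition interval_vec (R : realType) (n : nat) (u : 'I_n) : 'rV[R]_(n + n) :=
  \row_(k < n + n) (if (u <= k < u + n)%N then (Num.sqrt n%:R)^-1 else 0).

Lemma sum_interval (R : realType) (m a b : nat) : (b <= m)%N ->
  \sum_(k < m | (a <= k < b)%N) 1 = (b - a)%:R :> R.
Proof.
move=> bm; rewrite -(big_mkord (fun k => (a <= k < b)%N) (fun=> 1)).
by rewrite -sumr_const_nat (@big_nat_widenl _ _ _ a 0) //= (@big_nat_widen _ _ _ 0 b m) //.
Qed.

Lemma dot_interval_vec (R : realType) (n : nat) (u v : 'I_n) :
  dot (interval_vec R u) (interval_vec R v) = 1 - path_dist R u v.
Proof.
have un := ltn_ord u; have vn := ltn_ord v.
have n0 : n%:R != 0 :> R by rewrite pnatr_eq0; lia.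
wlog uv : u v un vn / (u <= v)%N.
  move=> wl; have [/wl|/ltnW vu] := leqP u v; first exact.
  rewrite path_dist_sym -wl //; apply: eq_bigr => k _; exact: mulrC.
(* For [u <= v] the intervals meet in [n - (v - u)] points, each contributing [1 / n]. *)
transitivity (\sum_(k < n + n | (v <= k < u + n)%N) (n%:R^-1 : R)).
  rewrite [RHS]big_mkcond; apply: eq_bigr => k _; rewrite !mxE.
  have -> : (v <= k < u + n)%N = (u <= k < u + n)%N && (v <= k < v + n)%N by lia.
  case: ifP => _; case: ifP => _; rewrite ?mulr0 ?mul0r //.
  by rewrite -invfM -expr2 sqr_sqrtr ?ler0n.
under eq_bigr do rewrite -[n%:R^-1]mulr1.
rewrite -mulr_sumr sum_interval; last by lia.
rewrite natrB ?natrD; last by lia.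
rewrite /path_dist distrC ger0_norm ?subr_ge0 ?ler_nat //.
by field.
Qed.

Lemma sdp_opt_cycle (R : realType) (n : nat) (hn : (3 <= n)%N) :
  2 * (1 - n%:R^-1) <= sdp_opt (cycle_instance R hn).
Proof.
have u0 : 'I_n by exists 0%N; lia.
have dist0 u : path_dist R u u = 0 :> R by rewrite /path_dist subrr normr0 mul0r.
have AE u : sdp_A (cycle_instance R hn) (@interval_vec R n) u = 2 * (1 - n%:R^-1).
  rewrite sdp_A_lp_A -(lp_A_path_dist R hn u) !lp_A_cycle.
  by rewrite /edge_score !dot_interval_vec !subKr.
apply: (@le_trans _ _ (min_over (sdp_A (cycle_instance R hn) (@interval_vec R n)))).
  by apply: le_min_over => // u; rewrite AE.
apply: ub_le_sup.
  exists 2 => _ [m [y [[y1 y0 _] ->]]].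
  apply: (le_trans (min_over_le _ u0)); rewrite sdp_A_lp_A.
  apply: lp_A_cycle_le2 => v.
  by have := y0 u0 v; have := dot_le1 (y1 u0) (y1 v) => ? ?; apply/andP; split; lra.
exists (n + n)%N, (@interval_vec R n); split=> //; split.
- by move=> u; rewrite dot_interval_vec dist0 subr0.
- by move=> u v; rewrite dot_interval_vec subr_ge0; case/andP: (path_dist_bounds R u v).
(* For these unit vectors the squared distance is twice [path_dist], so the triangle inequality of
   the latter suffices. *)
- move=> u v w; rewrite !sqnormB !dot_interval_vec !dist0.
  have := path_dist_triangle R u v w; lra.
Qed.

(** * Comparison of the bounds *)

(** The factor is the reciprocal of [2 * (1 - n%:R^-1)], so its product with [opt] is at least 1.
    Positivity of [opt] makes the gap a genuine ratio. *)
Lemma gap_bound (R : realType) (n : nat) (a opt : R) : (3 <= n)%N ->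
  a <= 1 -> 2 * (1 - n%:R^-1) <= opt ->
  0 < opt /\ a <= n%:R / (2 * (n%:R - 1)) * opt.
Proof.
move=> hn a1 le_opt.
have n3 : 3 <= n%:R :> R by rewrite ler_nat.
have n1_neq0 : n%:R - 1 != 0 :> R by apply: lt0r_neq0; lra.
have n_neq0 : n%:R != 0 :> R by apply: lt0r_neq0; lra.
split.
  apply: lt_le_trans le_opt; rewrite mulr_gt0 // subr_gt0 invf_lt1; lra.
apply: (le_trans a1).
have E : n%:R / (2 * (n%:R - 1)) * (2 * (1 - n%:R^-1)) = 1 :> R.
  by field; rewrite n_neq0.
by rewrite -[leLHS]E; apply: ler_wpM2l => //; rewrite divr_ge0 //; lra.
Qed.

Theorem theorem6 (R : realType) (n : nat) (hn : (3 <= n)%N) :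
  exists I : instance R 'I_n,
    [/\ unit_weights I,
        0 < lp_opt I /\
        max_min_agree I <= n%:R / (2 * (n%:R - 1)) * lp_opt I
      & 0 < sdp_opt I /\
        max_min_agree I <= n%:R / (2 * (n%:R - 1)) * sdp_opt I].
Proof.
exists (cycle_instance R hn); split=> //.
- exact: gap_bound (max_min_agree_cycle R hn) (lp_opt_cycle R hn).
- exact: gap_bound (max_min_agree_cycle R hn) (sdp_opt_cycle R hn).
Qed.
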